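(* Let $d=p+k$, $m_0\in(0,1)$, $m_1=1-m_0$, $h\in\mathbb{R}^d$. If $I(\theta_0)^{1/2}H_0=\{0\}^p\times\mathbb{R}^k$, then the asymptotic distribution of the split likelihood ratio statistic, i.e. the law of $$\Lambda_\infty=\Big\Vert X+\sqrt{m_0}\,I(\theta_0)^{1/2}h-I(\theta_0)^{1/2}H_0\Big\Vert^2-\Big\Vert X-\sqrt{\tfrac{m_0}{m_1}}\,Y\Big\Vert^2,\qquad X,Y\sim\mathcal N_d(0,\mathrm{Id})\text{ independent},$$ is the $d$-dimensional noncentral split chi-square distribution with $p$ degrees of freedom, noncentrality parameter $\tilde h^T\tilde h$ and splitting ratio $m_0$, where $\tilde h=[I(\theta_0)^{1/2}h]_{[p]}\in\mathbb{R}^p$. That is, $$\Lambda_\infty\overset{\mathcal D}{=}\Vert X_{[p]}+\sqrt{m_0}\,\tilde h\Vert^2-\Big\Vert X-\sqrt{\tfrac{m_0}{m_1}}\,Y\Big\Vert^2\;\sim\;\mathrm{split}_{m_0}\text{-}\chi^2_{p,d}(\tilde h^T\tilde h),$$ with $X,Y\sim\mathcal N_d(0,\mathrm{Id})$ independent.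
   Context: Here $I(\theta_0)$ is the $d\times d$ nonsingular Fisher information matrix (symmetric positive definite) of a model $\{P_\theta:\theta\in\Theta\subset\mathbb{R}^d\}$ at $\theta_0$, $I(\theta_0)^{1/2}$ is its symmetric square root, and $H_0\subset\mathbb{R}^d$ is the limit of the local null parameter spaces $\sqrt n(\Theta_0-\theta_0)$. The random variable $\Lambda_\infty$ displayed in the claim is the limit in distribution, under local alternatives $\theta_n=\theta_0+h/\sqrt n$, of the split likelihood ratio statistic with splitting ratio $m_0$ for testing $\theta\in\Theta_0$ against $\theta\in\Theta\setminus\Theta_0$. Definition. For $d\in\mathbb{N}$, $p\in\{0,\dots,d\}$, $\delta\ge0$, $m_0\in(0,1)$, the $d$-dimensional noncentral split chi-square distribution with $p$ degrees of freedom, noncentrality parameter $\delta$ and splitting ratio $m_0$, denoted $\mathrm{split}_{m_0}\text{-}\chi^2_{p,d}(\delta)$, is the distribution of $\Vert X_{[p]}+\sqrt{m_0}\,g\Vert^2-\Vert X-\sqrt{\tfrac{m_0}{1-m_0}}\,Y\Vert^2$, where $X,Y\sim\mathcal N_d(0,\mathrm{Id})$ are independent and $g\in\mathbb{R}^p$ is such that $g^Tg=\delta$ (the distribution depends on $g$ only through $g^Tg$). Notation: for a vector $x\in\mathbb{R}^d$, $x_{[p]}$ is the vector of its first $p$ components; $\Vert\cdot\Vert$ is the Euclidean norm; for a set $A\subset\mathbb{R}^d$, $\Vert x-A\Vert=\inf_{a\in A}\Vert x-a\Vert$; $I(\theta_0)^{1/2}H_0$ is the image of $H_0$ under $I(\theta_0)^{1/2}$;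 $\overset{\mathcal D}{=}$ is equality in distribution. *)

(* Defs.v *)
From HB Require Import structures.
From mathcomp Require Import all_boot all_order all_algebra.
From mathcomp Require Import all_classical all_reals all_analysis.
From mathcomp Require Import measurable_realfun.

Set Implicit Arguments.
Unset Strict Implicit.
Unset Printing Implicit Defensive.
Import Order.TTheory GRing.Theory Num.Theory.
Import numFieldNormedType.Exports.

Local Open Scope classical_set_scope.
Local Open Scope ring_scope.

(* The library norm on matrices is the sup norm, hence the definition below. *)
Definition enorm (R : realType) (n : nat) (x : 'cV[R]_n) : R :=
  Num.sqrt (\sum_(i < n) x i 0 ^+ 2).

Definition edist (R : realType) (n : nat) (x : 'cV[R]_n)
    (A : set 'cV[R]_n) : R :=
  inf [set enorm (x - a) | a in A].

Definition posdefmx (R : realType) (n : nat) (A : 'M[R]_n) : Prop :=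
  A^T = A /\ forall v : 'cV[R]_n, v != 0 -> 0 < (v^T *m A *m v) 0 0.

Definition possemidefmx (R : realType) (n : nat) (A : 'M[R]_n) : Prop :=
  A^T = A /\ forall v : 'cV[R]_n, 0 <= (v^T *m A *m v) 0 0.

(* B = A^(1/2): such a B exists and is unique when A is positive definite. *)
Definition is_sqrtmx (R : realType) (n : nat) (A B : 'M[R]_n) : Prop :=
  possemidefmx B /\ B *m B = A.

(* R^n carries the product sigma-algebra of n.-tuple; colv is the passage to
   column vectors, where the linear algebra takes place. *)
Definition colv (R : realType) (n : nat)
    (x : n.-tuple (measurableTypeR R)) : 'cV[R]_n :=
  \col_(i < n) tnth x i.

Section std_normal.
Context {R : realType}.
Local Notation RB := (measurableTypeR R).

Definition tcons (n : nat) (z : RB * n.-tuple RB) : n.+1.-tuple RB :=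
  [tuple of z.1 :: z.2].

Lemma measurable_tcons n : measurable_fun setT (@tcons n).
Proof. exact: measurable_cons. Qed.

HB.instance Definition _ n :=
  isMeasurableFun.Build _ _ _ _ (@tcons n) (@measurable_tcons n).

(* N_n(0, Id), the n-fold product of N(0, 1); the parameter 1 of normal_prob
   is the standard deviation. *)
Fixpoint std_normal (n : nat) : probability (n.-tuple RB) R :=
  match n with
  | 0 => \d_([tuple] : 0.-tuple RB)
  | m.+1 => distribution
      ((normal_prob (0 : R) 1 \x std_normal m)%E :
         probability (RB * m.-tuple RB)%type R) (@tcons m)
  end.

Lemma std_normal_box n (A : 'I_n -> set RB) :
  (forall i, measurable (A i)) ->
  std_normal n [set x | forall i, A i (tnth x i)] =
  (\prod_(i < n) normal_prob (0 : R) 1 (A i))%E.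
Proof.
elim: n A => [|n IH] A mA.
  rewrite big_ord0 /= diracE mem_set//=.
  by case.
rewrite big_ord_recl /=.
have := IH (fun i => A (lift ord0 i)) (fun i => mA _) => <-.
rewrite /distribution /pushforward.
rewrite (_ : _ @^-1` _ =
    A ord0 `*` [set x | forall i, A (lift ord0 i) (tnth x i)]); last first.
  apply/seteqP; split => [[a x]/= H|[a x]/= [H0 H] i].
  - split=> [|i]; first by have := H ord0; rewrite tnth0.
    by have := H (lift ord0 i); rewrite /tcons /= tnthS.
  - case: (unliftP ord0 i) => [j ->|->]; first by rewrite tnthS; exact: H.
    by rewrite tnth0.
apply: product_measure1E => //.
rewrite (_ : [set x | _] = \bigcap_(i in [set: 'I_n])
    ((fun x : n.-tuple RB => tnth x i) @^-1` A (lift ord0 i))); last first.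
  by apply/seteqP; split => [x H i _|x H i]; exact: H.
apply: fin_bigcap_measurable => // i _.
rewrite -[X in measurable X]setTI; exact: measurable_tnth.
Qed.

End std_normal.

Definition std_normal_vec d (T : measurableType d) (R : realType)
    (P : probability T R) (n : nat)
    (X : {mfun T >-> n.-tuple (measurableTypeR R)}) : Prop :=
  forall A, measurable A -> distribution P X A = std_normal n A.

Definition indep_vec d (T : measurableType d) (R : realType)
    (P : probability T R) (n : nat)
    (X Y : {mfun T >-> n.-tuple (measurableTypeR R)}) : Prop :=
  forall A B, measurable A -> measurable B ->
    P (X @^-1` A `&` Y @^-1` B) = (P (X @^-1` A) * P (Y @^-1` B))%E.

(* Limit of the split likelihood ratio statistic under local alternatives, as a
   function of the values x, y of the Gaussian vectors; S stands for the square
   root I(theta_0)^(1/2) of the Fisher information, and m1 for 1 - m0. *)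
Definition slr_limit (R : realType) (n : nat) (m0 m1 : R) (S : 'M[R]_n)
    (H0 : set 'cV[R]_n) (h x y : 'cV[R]_n) : R :=
  edist (x + Num.sqrt m0 *: (S *m h)) [set S *m u | u in H0] ^+ 2
  - enorm (x - Num.sqrt (m0 / m1) *: y) ^+ 2.

(* The dimension is d = p + k, so that x_[p] is the upper block of x. *)
Definition split_stat (R : realType) (p k : nat) (m0 : R) (g : 'cV[R]_p)
    (x y : 'cV[R]_(p + k)) : R :=
  enorm (usubmx x + Num.sqrt m0 *: g) ^+ 2
  - enorm (x - Num.sqrt (m0 / (1 - m0)) *: y) ^+ 2.

Section split_chi2.
Context {R : realType}.
Local Notation RB := (measurableTypeR R).

Definition split_map (p k : nat) (m0 : R) (g : 'cV[R]_p)
    (z : (p + k).-tuple RB * (p + k).-tuple RB) : RB :=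
  split_stat m0 g (colv z.1) (colv z.2).

Lemma enorm_sqr n (x : 'cV[R]_n) : enorm x ^+ 2 = \sum_(i < n) x i 0 ^+ 2.
Proof. by rewrite sqr_sqrtr// sumr_ge0// => i _; exact: sqr_ge0. Qed.

Lemma measurable_split_map p k (m0 : R) (g : 'cV[R]_p) :
  measurable_fun setT (@split_map p k m0 g).
Proof.
have m1 i : measurable_fun setT
    (fun z : (p + k).-tuple RB * (p + k).-tuple RB => tnth z.1 i : RB).
  by apply: (measurableT_comp (measurable_tnth i)).
have m2 i : measurable_fun setT
    (fun z : (p + k).-tuple RB * (p + k).-tuple RB => tnth z.2 i : RB).
  by apply: (measurableT_comp (measurable_tnth i)).
have -> : @split_map p k m0 g = fun z =>
    \sum_(i < p) (tnth z.1 (lshift k i) + Num.sqrt m0 * g i 0) ^+ 2 -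
    \sum_(i < p + k) (tnth z.1 i - Num.sqrt (m0 / (1 - m0)) * tnth z.2 i) ^+ 2.
  apply/funext => z; rewrite /split_map /split_stat !enorm_sqr.
  by congr (_ - _); apply: eq_bigr => i _; rewrite !mxE.
apply: measurable_funB; apply: measurable_sum => i; apply: measurable_funX.
  by apply: measurable_funD; [exact: m1|exact: measurable_cst].
apply: measurable_funB; first exact: m1.
by apply: measurable_funM; [exact: measurable_cst|exact: m2].
Qed.

HB.instance Definition _ p k m0 g :=
  isMeasurableFun.Build _ _ _ _ (@split_map p k m0 g)
    (@measurable_split_map p k m0 g).

(* The noncentral split chi-square distribution in dimension p + k. A vector g
   with g^T g = delta is selected by choice; the law does not depend on which
   one. Such a g exists if 0 <= delta and 0 < p, or if delta = 0. *)
Definition split_chi2 (p k : nat) (m0 delta : R) : probability RB R :=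
  distribution
    ((std_normal (p + k) \x std_normal (p + k))%E :
       probability ((p + k).-tuple RB * (p + k).-tuple RB)%type R)
    (@split_map p k m0 (xget 0 [set g : 'cV[R]_p | (g^T *m g) 0 0 = delta])).

End split_chi2.

Definition has_law d (T : measurableType d) (R : realType)
    (P : probability T R) (Z : T -> measurableTypeR R)
    (mu : probability (measurableTypeR R) R) : Prop :=
  measurable_fun setT Z /\
  forall A, measurable A -> pushforward P Z A = mu A.

Definition eq_in_law d1 d2 (T1 : measurableType d1) (T2 : measurableType d2)
    (R : realType) (P1 : probability T1 R) (P2 : probability T2 R)
    (Z1 : T1 -> measurableTypeR R) (Z2 : T2 -> measurableTypeR R) : Prop :=
  [/\ measurable_fun setT Z1, measurable_fun setT Z2 &
      forall A, measurable A -> pushforward P1 Z1 A = pushforward P2 Z2 A].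

(* Main.v *)
(* The distance from x to {0}^p x R^k is the norm of the first p coordinates of
   x, so the limit statistic is a fixed function of (X, Y), whose joint law is
   the product of two standard normal laws. What remains is that the split
   chi-square law depends on g only through g^T g: if g and g' have the same
   norm, a reflection H maps g to g', and H + Id, applied to both X and Y,
   preserves their joint law.
   Rotation invariance of the normal law: in the plane, a rotation preserves
   Lebesgue measure, being a product of three shears, and preserves the Gaussian
   density. In dimension n, induct: for Q orthogonal, a reflection of the last
   n - 1 coordinates followed by a rotation of the first two sends the first
   column of Q back to the first basis vector, so Q is a product of rotations of
   the first two coordinates and orthogonal maps fixing the first one. *)
From HB Require Import structures.
Require Import Defs.
From mathcomp Require Import all_boot all_order all_algebra.
From mathcomp Require Import all_classical all_reals all_analysis.
From mathcomp Require Import measurable_realfun ring lra.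
Import Order.TTheory GRing.Theory Num.Theory.
Import numFieldNormedType.Exports.
Local Open Scope classical_set_scope.
Local Open Scope ring_scope.

Set Implicit Arguments.
Unset Strict Implicit.
Unset Printing Implicit Defensive.

(** * Measure-preserving maps and uniqueness of product measures *)

Definition measure_preserving d (T : measurableType d) (R : realType)
    (mu : set T -> \bar R) (f : T -> T) : Prop :=
  measurable_fun setT f /\ forall A, measurable A -> mu (f @^-1` A) = mu A.

Lemma measure_preserving_comp d (T : measurableType d) (R : realType)
    (mu : set T -> \bar R) (f g : T -> T) :
  measure_preserving mu f -> measure_preserving mu g ->
  measure_preserving mu (f \o g).
Proof.
move=> [mf pf] [mg pg]; split; first exact: measurableT_comp.
move=> A mA; rewrite comp_preimage pg ?pf//.
by rewrite -[X in measurable X]setTI; exact: mf.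
Qed.

(** Rectangles determine a product of sigma-finite measures. Packing [f] as a measurable function
    makes its pushforward a measure, to which uniqueness applies. *)
Lemma pushforward_product_measure d d1 d2 (T : measurableType d)
    (T1 : measurableType d1) (T2 : measurableType d2) (R : realType)
    (mu : {measure set T -> \bar R})
    (m1 : {sigma_finite_measure set T1 -> \bar R})
    (m2 : {sigma_finite_measure set T2 -> \bar R}) (f : T -> T1 * T2) :
  measurable_fun setT f ->
  (forall A B, measurable A -> measurable B ->
    mu (f @^-1` (A `*` B)) = m1 A * m2 B)%E ->
  forall C, measurable C -> mu (f @^-1` C) = (m1 \x m2)%E C.
Proof.
move=> mf fE C mC; pose fM := isMeasurableFun.Build _ _ _ _ f mf.
pose g : {mfun T >-> (T1 * T2)%type} := HB.pack f fM.
exact/esym/(product_measure_unique (m' := pushforward mu g)).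
Qed.

(** * Rotation invariance of the planar Gaussian measure *)

Section plane.
Context {R : realType}.
Local Notation RB := (measurableTypeR R).
Local Notation leb := (@lebesgue_measure R).
Local Notation leb2 := (leb \x leb)%E.
Local Notation gauss := (normal_prob (0 : R) 1).
Local Notation gauss2 := (gauss \x gauss)%E.

Lemma measurable_lin_comb (a b : R) :
  measurable_fun setT (fun z : RB * RB => a * z.1 + b * z.2 : RB).
Proof.
apply: measurable_funD; apply: measurable_funM => //; exact: measurable_cst.
Qed.

(** Lebesgue measure is determined by its values on half-open intervals, and a translation keeps
    their length. *)
Lemma lebesgue_measureD (c : R) (A : set RB) : measurable A ->
  leb ((fun x => x + c) @^-1` A) = leb A.
Proof.
move=> mA; have mf : measurable_fun setT (fun x : RB => x + c : RB).
  by apply: measurable_funD => //; exact: measurable_cst.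
apply/esym.
apply: (lebesgue_measure_unique
  (mu := pushforward leb (fun x : RB => x + c : RB))).
move=> _ [[a b]] _ <-.
rewrite [RHS](_ : _ = leb `](a - c), (b - c)]%classic); last first.
  congr (leb _); apply/seteqP; split=> x /=;
    by rewrite !in_itv/= ltrBlDr lerBrDr.
rewrite !lebesgue_measure_itv/= !lte_fin ltrD2r -!EFinB.
by case: ifP => // _; congr (_%:E); ring.
exact: mA.
Qed.

Definition shear1 (a : R) (z : RB * RB) : RB * RB := (z.1, z.2 + a * z.1).

Definition shear2 (a : R) (z : RB * RB) : RB * RB := (z.1 + a * z.2, z.2).

Definition rotation (c s : R) (z : RB * RB) : RB * RB :=
  (c * z.1 + s * z.2, - s * z.1 + c * z.2).

Lemma measurable_rotation (c s : R) : measurable_fun setT (rotation c s).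
Proof. by apply: measurable_fun_pair; exact: measurable_lin_comb. Qed.

(** Tonelli: the section of the preimage at [x] is the section of [A] translated by [a * x]. *)
Lemma shear1_preserving (a : R) : measure_preserving leb2 (shear1 a).
Proof.
have mS : measurable_fun setT (shear1 a).
  apply: measurable_fun_pair => //.
  apply: measurable_funD => //; apply: measurable_funM => //.
split=> // A mA; rewrite /product_measure1.
apply: eq_integral => x _ /=.
rewrite -[RHS](lebesgue_measureD (a * x)); last exact: measurable_xsection.
by congr (leb _); apply/seteqP; split=> y /=; rewrite !xsectionE.
Qed.

Definition swap2 (z : RB * RB) : RB * RB := (z.2, z.1).

Lemma swap_preserving : measure_preserving leb2 (swap2).
Proof.
have mS : measurable_fun setT swap2 by exact: measurable_fun_pair.
split=> // A mA.
apply: (@pushforward_product_measure _ _ _ _ _ _ _ leb2) => // B C mB mC.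
rewrite (_ : _ @^-1` _ = C `*` B); last first.
  by apply/seteqP; split=> -[x y] /= [].
by rewrite muleC; exact: product_measure1E.
Qed.

Lemma shear2_preserving (a : R) : measure_preserving leb2 (shear2 a).
Proof.
rewrite (_ : shear2 a = swap2 \o (shear1 a \o swap2)) //.
apply: measure_preserving_comp; first exact: swap_preserving.
by apply: measure_preserving_comp;
  [exact: shear1_preserving|exact: swap_preserving].
Qed.

(* The shear decomposition uses tan of half the angle and fails for the half
   turn, which is a quarter turn applied twice. *)
Lemma rotation_preserving (c s : R) : c ^+ 2 + s ^+ 2 = 1 ->
  measure_preserving leb2 (rotation c s).
Proof.
have main (c' s' : R) : c' ^+ 2 + s' ^+ 2 = 1 -> 1 + c' != 0 ->
    measure_preserving leb2 (rotation c' s').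
  move=> cs c1; set t := s' / (1 + c').
  have s2 : s' ^+ 2 = 1 - c' ^+ 2 by rewrite -cs addrC addKr.
  have tE : t * (1 + c') = s' by rewrite /t divfK.
  (* Cancel [1 + c'] in [s' ^+ 2 = (1 - c') * (1 + c')]. *)
  have tsE : t * s' = 1 - c'.
    apply: (mulfI c1); rewrite mulrCA mulrA tE; ring: s2.
  rewrite (_ : rotation _ _ = shear2 t \o (shear1 (- s') \o shear2 t)).
    apply: measure_preserving_comp; first exact: shear2_preserving.
    by apply: measure_preserving_comp;
      [exact: shear1_preserving|exact: shear2_preserving].
  apply/funext => -[x y]; rewrite /rotation /shear1 /shear2 /=.
  congr pair.
    (* These are the entries of the composed shears; [2 - t * s'] equals [1 + c']. *)
    transitivity ((1 - t * s') * x + t * (2 - t * s') * y); last by ring.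
    by rewrite tsE -tE; ring.
  transitivity (- s' * x + (1 - t * s') * y); last by ring.
  by rewrite tsE; ring.
move=> cs; have [c1|] := eqVneq (1 + c) 0; last exact: main.
have cE : c = -1 by lra.
have sE : s = 0.
  by apply/eqP; rewrite -sqrf_eq0; apply/eqP; move: cs; rewrite cE; lra.
rewrite (_ : rotation c s = rotation 0 1 \o rotation 0 1).
  by apply: measure_preserving_comp; apply: main; rewrite ?addr0 ?oner_eq0//;
    ring.
by apply/funext => -[x y]; rewrite /rotation /= cE sE; congr pair; ring.
Qed.

Definition gauss2_density (z : RB * RB) : R :=
  normal_pdf 0 1 z.1 * normal_pdf 0 1 z.2.

Lemma gauss2_density_ge0 z : 0 <= gauss2_density z.
Proof. by rewrite mulr_ge0// normal_pdf_ge0. Qed.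

Lemma measurable_gauss2_density : measurable_fun setT gauss2_density.
Proof.
by apply: measurable_funM; (apply: measurableT_comp => //);
  exact: measurable_normal_pdf.
Qed.

Lemma gauss2_density_rotation (c s : R) : c ^+ 2 + s ^+ 2 = 1 ->
  gauss2_density \o rotation c s = gauss2_density.
Proof.
move=> cs; have s2 : s ^+ 2 = 1 - c ^+ 2 by rewrite -cs addrC addKr.
apply/funext => -[x y]; rewrite /gauss2_density /rotation /=.
rewrite !normal_pdfE ?oner_eq0// /normal_fun.
(* Grouping the constants and the exponentials leaves only the sum of the exponents to compare, a
   multiple of the squared norm. *)
rewrite mulrACA [RHS]mulrACA -!expRD; congr (_ * expR _).
rewrite !subr0 -!mulrDl; congr (_ / _); ring: s2.
Qed.

(** The candidate measure with the joint density; once it is known to be a measure, uniqueness of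
    products identifies it with [gauss2]. *)
Let nu (A : set (RB * RB)) := (\int[leb2]_(z in A) (gauss2_density z)%:E)%E.

Let nu0 : nu set0 = 0%E.
Proof. exact: integral_set0. Qed.

Let nu_ge0 A : (0 <= nu A)%E.
Proof. by apply: integral_ge0 => z _; rewrite lee_fin gauss2_density_ge0. Qed.

Let nu_sigma_additive : semi_sigma_additive nu.
Proof.
move=> F mF tF mUF; rewrite /nu ge0_integral_bigcup//; first last.
- by move=> z _; rewrite lee_fin gauss2_density_ge0.
- by apply: measurable_funTS; apply/measurable_EFinP;
    exact: measurable_gauss2_density.
apply: is_cvg_ereal_nneg_natsum_cond => n _ _; exact: nu_ge0.
Qed.

HB.instance Definition _ :=
  isMeasure.Build _ _ _ nu nu0 nu_ge0 nu_sigma_additive.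

Lemma gauss2E A : measurable A ->
  gauss2 A = (\int[leb2]_(z in A) (gauss2_density z)%:E)%E.
Proof.
move=> mA; rewrite -/(nu A).
apply: (product_measure_unique (m' := nu)) => // B C mB mC.
(* On a rectangle the restricted density factors, so Tonelli splits the integral into a product of
   two one-dimensional ones. *)
rewrite -[LHS]/(nu (B `*` C)) /nu integral_mkcond fubini_tonelli1/=; first last.
- move=> z; rewrite erestrict_ge0// => ? _.
  by rewrite lee_fin gauss2_density_ge0.
- apply/(measurable_restrictT _ (measurableX mB mC)).
  by apply: measurable_funTS; apply/measurable_EFinP;
    exact: measurable_gauss2_density.
pose phi (D : set RB) := (fun x => (normal_pdf (0 : R) 1 x)%:E) \_ D.
have phi_ge0 D x : (0 <= phi D x)%E.
  by rewrite erestrict_ge0// => ? _; rewrite lee_fin normal_pdf_ge0.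
have mphi D : measurable D -> measurable_fun setT (phi D).
  move=> mD; apply/(measurable_restrictT _ mD).
  by apply: measurable_funTS; apply/measurable_EFinP;
    exact: measurable_normal_pdf.
rewrite /normal_prob [in RHS]integral_mkcond [X in (_ * X)%E]integral_mkcond.
rewrite -/(phi B) -/(phi C) -ge0_integralZr//; first last.
- exact: integral_ge0.
- exact: mphi.
apply: eq_integral => x _; rewrite /fubini_F -ge0_integralZl//; last first.
  exact: mphi.
apply: eq_integral => y _; rewrite /phi /patch in_setX/= /gauss2_density.
by case: (x \in B); case: (y \in C); rewrite ?(EFinM, mule0, mul0e).
Qed.

Lemma gauss2_rotation (c s : R) : c ^+ 2 + s ^+ 2 = 1 ->
  measure_preserving gauss2 (rotation c s).
Proof.
move=> cs; have [mr pr] := rotation_preserving cs; split.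
  exact: mr.
move=> A mA.
have mrA : measurable (rotation c s @^-1` A).
  by rewrite -[X in measurable X]setTI; exact: mr.
rewrite (gauss2E mrA) (gauss2E mA).
transitivity (\int[leb2]_(z in rotation c s @^-1` A)
    ((EFin \o gauss2_density) \o rotation c s) z)%E.
  by apply: eq_integral => z _; rewrite -[in LHS](gauss2_density_rotation cs).
have mg : measurable_fun A (EFin \o gauss2_density).
  by apply: measurable_funTS; apply/measurable_EFinP;
    exact: measurable_gauss2_density.
have g_ge0 : {in A, forall z, 0 <= (EFin \o gauss2_density) z}%E.
  by move=> z _; rewrite lee_fin gauss2_density_ge0.
(* Change of variables turns the integral into one against the pushforward of [leb2] by the
   rotation, which agrees with [leb2] by [pr]. *)
have := @ge0_integral_pushforward _ _ _ _ R _ mr leb2 A _ mA mg g_ge0.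
move=> <-; apply: eq_measure_integral => B mB _; exact: pr.
Qed.

(** The first marginal of the half turn, read off on strips [A] times the line. *)
Lemma gaussN : measure_preserving gauss (-%R : RB -> RB).
Proof.
have mN : measurable_fun setT (-%R : RB -> RB) by [].
split=> // A mA.
have mNA : measurable (-%R @^-1` A : set RB).
  by rewrite -[X in measurable X]setTI; exact: mN.
have cs : (-1 : R) ^+ 2 + 0 ^+ 2 = 1 by ring.
have := (gauss2_rotation cs).2 (A `*` setT) (measurableX mA measurableT).
rewrite (_ : _ @^-1` _ = (-%R @^-1` A) `*` setT); last first.
  by apply/seteqP; split=> -[x y] /=; rewrite mul0r addr0 mulN1r.
have E B : measurable B -> gauss2 (B `*` setT) = gauss B.
  by move=> mB; rewrite product_measure1E//= probability_setT mule1.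
by rewrite !E.
Qed.

End plane.

(** * Orthogonal matrices: reflections, block forms and plane rotations *)

Section orthogonal_matrices.
Context {R : realType}.

Definition orthogonalmx n (Q : 'M[R]_n) : Prop := Q^T *m Q = 1%:M.

Lemma orthogonalmx1 n : orthogonalmx (1%:M : 'M[R]_n).
Proof. by rewrite /orthogonalmx trmx1 mulmx1. Qed.

Lemma orthogonalmxM n (A B : 'M[R]_n) :
  orthogonalmx A -> orthogonalmx B -> orthogonalmx (A *m B).
Proof.
move=> oA oB; rewrite /orthogonalmx trmx_mul mulmxA -(mulmxA _ A^T) oA.
by rewrite mulmx1.
Qed.

Lemma orthogonalmx_tr n (A : 'M[R]_n) : orthogonalmx A -> orthogonalmx A^T.
Proof. by move=> oA; rewrite /orthogonalmx trmxK; exact: mulmx1C. Qed.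

Lemma orthogonalmx_block m n (A : 'M[R]_m) (B : 'M[R]_n) :
  orthogonalmx A -> orthogonalmx B -> orthogonalmx (block_mx A 0 0 B).
Proof.
move=> oA oB; rewrite /orthogonalmx tr_block_mx !trmx0 mulmx_block.
by rewrite !mulmx0 !mul0mx !addr0 !add0r oA oB -scalar_mx_block.
Qed.

Lemma trmx_mul_self n (v : 'cV[R]_n) : (v^T *m v) 0 0 = \sum_i v i 0 ^+ 2.
Proof. by rewrite mxE; apply: eq_bigr => i _; rewrite mxE. Qed.

Lemma trmx_mul_self_eq0 n (v : 'cV[R]_n) : (v^T *m v) 0 0 = 0 -> v = 0.
Proof.
rewrite trmx_mul_self => /eqP.
rewrite psumr_eq0 => [/allP v0|i _]; last exact: sqr_ge0.
apply/colP => i; rewrite mxE; apply/eqP; rewrite -sqrf_eq0.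
by apply: v0; rewrite mem_index_enum.
Qed.

(* The reflection in the hyperplane orthogonal to u - v. *)
Lemma orthogonalmx_transitive n (u v : 'cV[R]_n) :
  u^T *m u = v^T *m v -> exists2 Q : 'M[R]_n, orthogonalmx Q & Q *m u = v.
Proof.
move=> uv; have [w wE] : {w | w = u - v} by exists (u - v).
have [w0|w0] := eqVneq w 0.
  exists 1%:M; first exact: orthogonalmx1.
  by rewrite mul1mx; apply/eqP; rewrite -subr_eq0 -wE w0.
set a := (w^T *m w) 0 0.
have wwE : w^T *m w = a%:M by exact: mx11_scalar.
have a0 : a != 0.
  by apply: contra_neq w0; exact: trmx_mul_self_eq0.
(* As [u] and [v] have equal norms, [w^T *m w] is twice [w^T *m u]; hence subtracting [2 / a] times
   the projection term removes exactly [w] from [u]. *)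
have wuE : w^T *m u = (a / 2)%:M.
  have vuE : v^T *m u = u^T *m v.
    rewrite [LHS]mx11_scalar [RHS]mx11_scalar -[v^T *m u]trmxK trmx_mul trmxK.
    by rewrite [in LHS]mxE.
  have : w^T *m w = 2 *: (w^T *m u).
    rewrite wE [(u - v)^T]linearB /= mulmxBr !mulmxBl -uv vuE scalerBr.
    by rewrite !scaler_nat !mulr2n opprB addrACA opprD addrACA.
  rewrite wwE => /(congr1 ( *:%R 2^-1)); rewrite scalerA mulVf ?pnatr_eq0//.
  by rewrite scale1r scale_scalar_mx mulrC.
pose Q : 'M[R]_n := 1%:M - (2 / a) *: (w *m w^T).
have QT : Q^T = Q by rewrite /Q linearB linearZ /= trmx1 trmx_mul trmxK.
exists Q.
(* With this identity the symmetric matrix [Q] squares to the identity. *)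
- have PP : (w *m w^T) *m (w *m w^T) = a *: (w *m w^T).
    by rewrite mulmxA -(mulmxA w) wwE mul_mx_scalar scalemxAl.
  rewrite /orthogonalmx QT /Q; move: (w *m w^T) PP => P PP.
  rewrite mulmxBr mulmx1 mulmxBl mul1mx -scalemxAl -scalemxAr PP.
  rewrite !scalerA -addrA -scaleNr -!scalerBl.
  by rewrite (_ : _ - _ = 0) ?scale0r ?addr0//; field.
- rewrite /Q mulmxBl mul1mx -scalemxAl -mulmxA wuE mul_mx_scalar scalerA.
  rewrite (_ : 2 / a * (a / 2) = 1); last by field.
  by rewrite scale1r wE opprB addrC subrK.
Qed.

(** Orthogonality makes [M^T] fix the first basis vector too, so the first row as well as the first
    column of [M] is that of the identity. *)
Lemma orthogonalmx_fix_e0 n (M : 'M[R]_(1 + n)) :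
  orthogonalmx M -> M *m col_mx 1%:M 0 = col_mx 1%:M 0 ->
  exists2 Q : 'M[R]_n, orthogonalmx Q & M = block_mx 1%:M 0 0 Q.
Proof.
move=> oM; rewrite -[M in X in X -> _]submxK => Me.
have MTe : M^T *m col_mx 1%:M 0 = col_mx 1%:M 0 :> 'cV_(1 + n).
  by rewrite -{1}Me submxK mulmxA oM mul1mx.
move: Me; rewrite mul_block_col !mulmx0 !mulmx1 !addr0 => /eq_col_mx[ul dl].
move: MTe; rewrite -{1}[M]submxK tr_block_mx mul_block_col.
rewrite !mulmx0 !mulmx1 !addr0.
move=> /eq_col_mx[_ /(congr1 trmx)]; rewrite trmxK trmx0 => ur.
have ME : M = block_mx 1%:M 0 0 (drsubmx M) by rewrite -{1}[M]submxK ul dl ur.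
exists (drsubmx M) => //; move: oM; rewrite /orthogonalmx {1 2}ME tr_block_mx.
rewrite mulmx_block !trmx0 !mul0mx !mulmx0 !add0r => /(congr1 drsubmx).
by rewrite block_mxKdr scalar_mx_block block_mxKdr.
Qed.

(* The blocks are nested as 1 + (1 + n) to match two applications of tcons. *)
Definition givensmx n (c s : R) : 'M[R]_(1 + (1 + n)) :=
  block_mx c%:M (row_mx s%:M 0)
    (col_mx (- s)%:M 0) (block_mx c%:M 0 0 1%:M).

Lemma tr_givensmx n (c s : R) : (givensmx n c s)^T = givensmx n c (- s).
Proof.
rewrite /givensmx tr_block_mx tr_row_mx tr_col_mx tr_block_mx.
by rewrite !tr_scalar_mx !trmx0 opprK.
Qed.

Lemma mul_givensmx n m (c s : R) (a b : 'rV[R]_m) (x : 'M[R]_(n, m)) :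
  givensmx n c s *m col_mx a (col_mx b x) =
  col_mx (c *: a + s *: b) (col_mx (- s *: a + c *: b) x).
Proof.
rewrite /givensmx mul_block_col mul_row_col mul_col_mx mul_block_col.
rewrite add_col_mx.
by rewrite !mul_scalar_mx !mul0mx scale1r !addr0 !add0r.
Qed.

Lemma orthogonalmx_givens n (c s : R) : c ^+ 2 + s ^+ 2 = 1 ->
  orthogonalmx (givensmx n c s).
Proof.
move=> cs; have s2 : s ^+ 2 = 1 - c ^+ 2 by rewrite -cs addrC addKr.
(* The identity is cut into row blocks [a], [b], [x], so that two applications of [mul_givensmx]
   compute the product. *)
rewrite /orthogonalmx tr_givensmx -[RHS](@vsubmxK R 1 (1 + n) _ 1%:M).
rewrite -[X in _ = col_mx _ X]vsubmxK.
set a := usubmx _; set b := usubmx _; set x := dsubmx _.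
rewrite {1}(_ : givensmx n c s = givensmx n c s *m col_mx a (col_mx b x));
  last first.
  by rewrite !vsubmxK mulmx1.
rewrite !mul_givensmx !scalerDr !scalerA; congr col_mx; last congr col_mx.
- rewrite addrACA -!scalerDl (_ : c * c + _ = 1); last by ring: s2.
  by rewrite (_ : c * s + _ = 0) ?scale1r ?scale0r ?addr0//; ring.
- rewrite addrACA -!scalerDl (_ : - - s * s + _ = 1); last by ring: s2.
  by rewrite (_ : - - s * c + _ = 0) ?scale1r ?scale0r ?add0r//; ring.
Qed.

End orthogonal_matrices.

(** * Products of measure-preserving maps and associativity of product measures *)

Lemma measure_preserving_prod d1 d2 (T1 : measurableType d1)
    (T2 : measurableType d2) (R : realType)
    (m1 : {sigma_finite_measure set T1 -> \bar R})
    (m2 : {sigma_finite_measure set T2 -> \bar R})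
    (f : T1 -> T1) (g : T2 -> T2) :
  measure_preserving m1 f -> measure_preserving m2 g ->
  measure_preserving (m1 \x m2)%E (fun z => (f z.1, g z.2)).
Proof.
move=> [mf pf] [mg pg].
have mfg : measurable_fun setT (fun z : T1 * T2 => (f z.1, g z.2)).
  by apply: measurable_fun_pair; apply: measurableT_comp.
split=> //.
apply: (pushforward_product_measure (mu := (m1 \x m2)%E)) => // A B mA mB.
have mfA : measurable (f @^-1` A).
  by rewrite -[X in measurable X]setTI; exact: mf.
have mgB : measurable (g @^-1` B).
  by rewrite -[X in measurable X]setTI; exact: mg.
rewrite -(pf _ mA) -(pg _ mB).
by rewrite -[RHS](product_measure1E m1 m2 mfA mgB).
Qed.

(** By Tonelli both sides are the same iterated integral of the [m3]-measure of sections. *)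
Lemma product_measureA d1 d2 d3 (T1 : measurableType d1)
    (T2 : measurableType d2) (T3 : measurableType d3) (R : realType)
    (m1 : {sigma_finite_measure set T1 -> \bar R})
    (m2 : {sigma_finite_measure set T2 -> \bar R})
    (m3 : {sigma_finite_measure set T3 -> \bar R}) (C : set (T1 * (T2 * T3))) :
  measurable C ->
  ((m1 \x m2) \x m3)%E ((fun w => (w.1.1, (w.1.2, w.2))) @^-1` C) =
  (m1 \x (m2 \x m3))%E C.
Proof.
move=> mC; set D := _ @^-1` C.
have mD : measurable D.
  rewrite -[X in measurable X]setTI.
  apply: (measurable_fun_pair (f := _ \o _)) => //.
    exact: measurableT_comp.
  by apply: measurable_fun_pair => //; exact: measurableT_comp.
rewrite [LHS](fubini_tonelli1 (m3 \o xsection D)) => [|//|z]; last first.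
- exact: measure_ge0.
- exact: measurable_fun_xsection.
apply: eq_integral => x _; apply: eq_integral => y _ /=.
by congr (m3 _); apply/seteqP; split=> z; rewrite /xsection /= !inE /= !inE.
Qed.

(** * Orthogonal invariance of the standard normal law in dimension n *)

Section std_normal_invariance.
Context {R : realType}.
Local Notation RB := (measurableTypeR R).
Local Notation gauss := (normal_prob (0 : R) 1).
Local Notation gauss2 := (gauss \x gauss)%E.

Definition mulmx_tuple n (Q : 'M[R]_n) (x : n.-tuple RB) : n.-tuple RB :=
  [tuple (Q *m colv x) i 0 | i < n].

Lemma colv_mulmx_tuple n (Q : 'M[R]_n) x : colv (mulmx_tuple Q x) = Q *m colv x.
Proof. by apply/colP => i; rewrite mxE tnth_mktuple. Qed.

Lemma colv_inj n : injective (@colv R n).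
Proof.
move=> x y xy; apply: eq_from_tnth => i.
by have /colP/(_ i) := xy; rewrite !mxE.
Qed.

Lemma colv_tcons n (z : RB * n.-tuple RB) :
  colv (tcons z) = col_mx (z.1)%:M (colv z.2).
Proof.
apply/colP => i; case: (@split_ordP 1 n i) => j ->.
  rewrite [RHS]col_mxEu !mxE ord1 eqxx mulr1n.
  by rewrite (_ : lshift n 0 = ord0) ?tnth0//; apply: val_inj.
rewrite [RHS]col_mxEd !mxE.
by rewrite (_ : rshift 1 j = lift ord0 j) ?tnthS//; apply: val_inj.
Qed.

Lemma mulmx_tupleM n (A B : 'M[R]_n) :
  mulmx_tuple (A *m B) = mulmx_tuple A \o mulmx_tuple B.
Proof.
by apply/funext => x; apply: colv_inj; rewrite /= !colv_mulmx_tuple mulmxA.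
Qed.

Lemma measurable_mulmx_tuple n (Q : 'M[R]_n) :
  measurable_fun setT (mulmx_tuple Q).
Proof.
apply/measurable_fun_tnthP => i.
rewrite (_ : _ \o _ = fun x => \sum_j Q i j * tnth x j); last first.
  apply/funext => x; rewrite /= tnth_mktuple mxE.
  by apply: eq_bigr => j _; rewrite mxE.
apply: measurable_sum => j; apply: measurable_funM; first exact: measurable_cst.
exact: measurable_tnth.
Qed.

(** Through [tcons], a block-diagonal matrix acts as a product map on the first coordinate and the
    rest. *)
Lemma std_normal_mulmx_block n (a : R) (Q : 'M[R]_n) :
  measure_preserving gauss (fun x : RB => a * x : RB) ->
  measure_preserving (std_normal n) (mulmx_tuple Q) ->
  measure_preserving (std_normal n.+1)
    (mulmx_tuple (block_mx a%:M 0 0 Q : 'M[R]_(1 + n))).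
Proof.
move=> pa pQ; split=> [|A mA]; first exact: measurable_mulmx_tuple.
have [mp pp] := measure_preserving_prod pa pQ.
have mtA : measurable (@tcons R n @^-1` A).
  by rewrite -[X in measurable X]setTI; exact: measurable_tcons.
rewrite -[RHS]/((gauss \x std_normal n)%E (@tcons R n @^-1` A)) -(pp _ mtA).
congr ((gauss \x std_normal n)%E _); apply/funext => z /=.
congr A; apply: colv_inj; rewrite colv_mulmx_tuple !colv_tcons.
apply: etrans; first exact: (@mul_block_col R 1 n 1 n 1).
by rewrite !mul0mx addr0 add0r colv_mulmx_tuple -scalar_mxM.
Qed.

Definition tcons2 n (w : (RB * RB) * n.-tuple RB) : n.+2.-tuple RB :=
  tcons (w.1.1, tcons (w.1.2, w.2)).

Lemma measurable_tcons2 n : measurable_fun setT (@tcons2 n).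
Proof.
apply: measurable_cons.
  exact: (measurableT_comp measurable_fst measurable_fst).
apply: measurable_cons; last exact: measurable_snd.
exact: (measurableT_comp measurable_snd measurable_fst).
Qed.

(** Isolates the first two coordinates as a planar Gaussian factor, on which a plane rotation
    acts. *)
Lemma std_normalSS n (A : set (n.+2.-tuple RB)) : measurable A ->
  std_normal n.+2 A = (gauss2 \x std_normal n)%E (@tcons2 n @^-1` A).
Proof.
move=> mA; have mtA : measurable (@tcons2 n @^-1` A).
  by rewrite -[X in measurable X]setTI; exact: measurable_tcons2.
rewrite -[LHS]/((gauss \x (gauss \x std_normal n))%E
  ((fun z => tcons (z.1, tcons z.2)) @^-1` A)).
rewrite -product_measureA//.
rewrite -[X in measurable X]setTI; suff : measurable_fun setT
  (fun z : RB * (RB * n.-tuple RB) => tcons (z.1, tcons z.2)) by apply.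
apply: measurable_cons; first exact: measurable_fst.
exact: (measurableT_comp (@measurable_tcons R n) measurable_snd).
Qed.

Lemma std_normal_givens n (c s : R) : c ^+ 2 + s ^+ 2 = 1 ->
  measure_preserving (std_normal n.+2) (mulmx_tuple (givensmx n c s)).
Proof.
move=> cs; split=> [|A mA]; first exact: measurable_mulmx_tuple.
have pid : measure_preserving (std_normal n) (id : n.-tuple RB -> n.-tuple RB).
  by split.
have [mp pp] := measure_preserving_prod
  (m1 := gauss2 : probability (RB * RB)%type R) (m2 := std_normal n)
  (gauss2_rotation cs) pid.
have mtA : measurable (@tcons2 n @^-1` A).
  by rewrite -[X in measurable X]setTI; exact: measurable_tcons2.
have mgA : measurable (mulmx_tuple (givensmx n c s) @^-1` A).
  by rewrite -[X in measurable X]setTI; exact: measurable_mulmx_tuple.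
rewrite (std_normalSS mgA) (std_normalSS mA) -(pp _ mtA).
congr ((gauss2 \x std_normal n)%E _); apply/funext => -[[a b] x] /=.
congr A; apply: colv_inj; rewrite colv_mulmx_tuple !colv_tcons.
apply: etrans; first exact: (@mul_givensmx R n 1).
by rewrite !scale_scalar_mx -!raddfD.
Qed.

Lemma std_normal_orthogonal n (Q : 'M[R]_n) : orthogonalmx Q ->
  measure_preserving (std_normal n) (mulmx_tuple Q).
Proof.
elim: n Q => [|n IH] Q oQ.
  rewrite (_ : mulmx_tuple Q = id); first by split.
  by apply/funext => x; rewrite [LHS]tuple0 [RHS]tuple0.
have p1 : measure_preserving gauss (fun x : RB => 1 * x : RB).
  by rewrite (_ : (fun x => _) = id) //; apply/funext => x; rewrite mul1r.
(* Dimension 1 is treated apart, having no plane to rotate: the single entry of [Q] is 1 or -1. *)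
case: n => [|n] in Q oQ IH *.
  have QE : Q = block_mx (Q 0 0)%:M 0 0 (1%:M : 'M[R]_0) :> 'M[R]_(1 + 0).
    apply/matrixP => i j; case: (@split_ordP 1 0 i) => [i' ->|[]//].
    case: (@split_ordP 1 0 j) => [j' ->|[]//].
    by rewrite [RHS]block_mxEul mxE !ord1 eqxx; congr (Q _ _); exact: val_inj.
  rewrite QE; apply: std_normal_mulmx_block.
    have : (Q^T *m Q) 0 0 = 1 by rewrite oQ mxE.
    rewrite mxE big_ord1 mxE -expr2 => /eqP.
    rewrite sqrf_eq1 => /orP[] /eqP ->; first exact: p1.
    rewrite (_ : (fun x => _) = -%R); first exact: gaussN.
    by apply/funext => x; rewrite mulN1r.
  by apply: IH; exact: orthogonalmx1.
pose e0 : 'cV[R]_(1 + n.+1) := col_mx 1%:M 0.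
have e0E : e0^T *m e0 = 1%:M.
  by rewrite tr_col_mx mul_row_col trmx0 mul0mx addr0 trmx1 mulmx1.
have [w wE] : {w : 'cV[R]_(1 + n.+1) | w = Q *m e0} by exists (Q *m e0).
(* [w] is the first column of [Q], a unit vector; its first coordinate [a] and the norm [r] of the
   remaining ones serve as cosine and sine. *)
set a := usubmx w 0 0; set r := Num.sqrt (((dsubmx w)^T *m dsubmx w) 0 0).
have r2 : ((dsubmx w)^T *m dsubmx w) 0 0 = r ^+ 2.
  by rewrite sqr_sqrtr// trmx_mul_self sumr_ge0// => i _; exact: sqr_ge0.
have ar : a ^+ 2 + r ^+ 2 = 1.
  have : (w^T *m w) 0 0 = 1.
    by rewrite wE trmx_mul mulmxA -(mulmxA _ Q^T) oQ mulmx1 e0E mxE.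
  rewrite -[w]vsubmxK tr_col_mx mul_row_col [LHS]mxE r2 trmx_mul_self big_ord1.
  by [].
have [H oH Hw] : exists2 H : 'M[R]_(1 + n), orthogonalmx H &
    H *m dsubmx w = col_mx r%:M 0.
  apply: orthogonalmx_transitive; rewrite [LHS]mx11_scalar r2.
  by rewrite tr_col_mx mul_row_col trmx0 mul0mx addr0 tr_scalar_mx -scalar_mxM.
pose B := block_mx 1%:M 0 0 H : 'M[R]_(1 + (1 + n)).
pose G := givensmx n a r.
have oB : orthogonalmx B.
  by apply: orthogonalmx_block => //; exact: orthogonalmx1.
have oG : orthogonalmx G by exact: orthogonalmx_givens.
(* [B] moves the first column of [Q] to [(a, r, 0)], and [G] rotates that to the first basis
   vector. *)
have [K oK ME] : exists2 K : 'M[R]_(1 + n), orthogonalmx K &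
    G *m B *m Q = block_mx 1%:M 0 0 K.
  apply: orthogonalmx_fix_e0.
    by apply: orthogonalmxM => //; exact: orthogonalmxM.
  rewrite -!mulmxA -wE -[w]vsubmxK mul_block_col !mul0mx mul1mx addr0 add0r Hw.
  rewrite [usubmx w]mx11_scalar -/a mul_givensmx !scale_scalar_mx -!raddfD /=.
  by rewrite -!expr2 ar mulNr mulrC addNr raddf0 -col_mx0.
have -> : Q = B^T *m G^T *m block_mx 1%:M 0 0 K.
  by rewrite -ME !mulmxA -(mulmxA _ G^T) oG mulmx1 oB mul1mx.
rewrite !mulmx_tupleM.
apply: measure_preserving_comp; last first.
  by apply: std_normal_mulmx_block => //; exact: IH.
apply: measure_preserving_comp.
  rewrite /B tr_block_mx !trmx0 tr_scalar_mx.
  apply: std_normal_mulmx_block => //.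
  by apply: IH; exact: orthogonalmx_tr.
rewrite tr_givensmx; apply: std_normal_givens.
by rewrite sqrrN.
Qed.

End std_normal_invariance.

(** * Euclidean norm, distance to the coordinate subspace, and the split statistic *)

Lemma enorm_mul_orthogonal (R : realType) n (Q : 'M[R]_n) (x : 'cV[R]_n) :
  orthogonalmx Q -> enorm (Q *m x) = enorm x.
Proof.
move=> oQ; rewrite /enorm -!trmx_mul_self trmx_mul mulmxA -(mulmxA _ Q^T) oQ.
by rewrite mulmx1.
Qed.

Lemma edist_usubmx0 (R : realType) p k (x : 'cV[R]_(p + k)) :
  Defs.edist x [set y | usubmx y = 0] = enorm (usubmx x).
Proof.
apply/eqP; rewrite eq_le; apply/andP; split.
- apply: ge_inf.
    by exists 0 => _ [y _ <-]; exact: sqrtr_ge0.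
  (* The nearest point: the orthogonal projection of [x] onto the subspace. *)
  exists (col_mx 0 (dsubmx x)); first by rewrite /= col_mxKu.
  rewrite -{1}[x]vsubmxK opp_col_mx add_col_mx subr0 subrr /enorm.
  congr Num.sqrt.
  rewrite big_split_ord /= [X in _ + X]big1 ?addr0 => [|i _].
    by apply: eq_bigr => i _; rewrite col_mxEu.
  by rewrite col_mxEd mxE expr0n.
- apply: lb_le_inf.
    by exists (enorm (x - 0)); exists 0 => //=; rewrite raddf0.
  move=> _ [y /= y0 <-]; rewrite /enorm ler_sqrt; last first.
    by apply: sumr_ge0 => i _; exact: sqr_ge0.
  rewrite [leRHS]big_split_ord /=.
  (* Subtracting a point of the subspace leaves the upper block unchanged, and the lower block only
     adds nonnegative squares. *)
  have -> : usubmx x = usubmx (x - y) by rewrite raddfB /= y0 subr0.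
  rewrite [leRHS](_ : _ = \sum_i usubmx (x - y) i 0 ^+ 2 +
    \sum_i (x - y) (rshift p i) 0 ^+ 2); last first.
    by congr (_ + _); apply: eq_bigr => i _; rewrite [in RHS]mxE.
  by rewrite lerDl sumr_ge0// => i _; exact: sqr_ge0.
Qed.

(** [Q] acts on upper blocks as [H], and both matrices preserve the norm, so each of the two squared
    norms is unchanged. *)
Lemma split_stat_orthogonal (R : realType) p k (m0 : R) (H : 'M[R]_p)
    (g : 'cV[R]_p) (x y : 'cV[R]_(p + k)) :
  orthogonalmx H -> let Q := block_mx H 0 0 1%:M in
  split_stat m0 (H *m g) (Q *m x) (Q *m y) = split_stat m0 g x y.
Proof.
move=> oH Q; have oQ : orthogonalmx Q.
  by apply: orthogonalmx_block => //; exact: orthogonalmx1.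
rewrite /split_stat; congr (_ ^+ 2 - _ ^+ 2).
  rewrite -{1}[x]vsubmxK mul_block_col col_mxKu mul0mx addr0 scalemxAr -mulmxDr.
  exact: enorm_mul_orthogonal.
by rewrite scalemxAr -mulmxBr enorm_mul_orthogonal.
Qed.

(** * The law of the split statistic *)

Section split_law.
Context {R : realType}.
Local Notation RB := (measurableTypeR R).

Lemma split_map_law p k (m0 : R) (g g' : 'cV[R]_p) (A : set RB) :
  g^T *m g = g'^T *m g' -> measurable A ->
  (std_normal (p + k) \x std_normal (p + k))%E (split_map m0 g @^-1` A) =
  (std_normal (p + k) \x std_normal (p + k))%E (split_map m0 g' @^-1` A).
Proof.
move=> gg' mA; have [H oH Hg] := orthogonalmx_transitive (esym gg').
pose Q : 'M[R]_(p + k) := block_mx H 0 0 1%:M.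
have oQ : orthogonalmx Q.
  by apply: orthogonalmx_block => //; exact: orthogonalmx1.
have pQ := std_normal_orthogonal oQ.
(* The set on the left is replaced by its preimage under [Q] acting on both vectors; since
   [g = H *m g'], this is the set on the right. *)
have [_ <-] := measure_preserving_prod pQ pQ; last first.
  by rewrite -[X in measurable X]setTI; exact: measurable_split_map.
congr ((std_normal (p + k) \x std_normal (p + k))%E _); apply/funext => z /=.
by congr A; rewrite /split_map /= !colv_mulmx_tuple -Hg split_stat_orthogonal.
Qed.

(** Independence gives the product formula on rectangles, which determines the joint law. *)
Lemma law_indep_std_normal d (T : measurableType d) (P : probability T R) n
    (X Y : {mfun T >-> n.-tuple RB}) :
  std_normal_vec P X -> std_normal_vec P Y -> indep_vec P X Y ->
  forall C, measurable C ->
  P ((fun t => (X t, Y t)) @^-1` C) = (std_normal n \x std_normal n)%E C.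
Proof.
move=> hX hY hXY; apply: pushforward_product_measure.
  by apply: measurable_fun_pair.
move=> A B mA mB; apply: etrans (hXY A B mA mB) _.
by congr (_ * _)%E; [exact: hX|exact: hY].
Qed.

Lemma pushforward_split_stat d (T : measurableType d) (P : probability T R) p k
    (X Y : {mfun T >-> (p + k).-tuple RB}) (m0 : R) (g : 'cV[R]_p) :
  std_normal_vec P X -> std_normal_vec P Y -> indep_vec P X Y ->
  forall A, measurable A ->
  pushforward P (fun t => split_stat m0 g (colv (X t)) (colv (Y t)) : RB) A =
  (std_normal (p + k) \x std_normal (p + k))%E (split_map m0 g @^-1` A).
Proof.
move=> hX hY hXY A mA; rewrite -(law_indep_std_normal hX hY hXY)//.
by rewrite -[X in measurable X]setTI; exact: measurable_split_map.
Qed.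

Lemma measurable_split_stat d (T : measurableType d) p k
    (X Y : {mfun T >-> (p + k).-tuple RB}) (m0 : R) (g : 'cV[R]_p) :
  measurable_fun setT
    (fun t => split_stat m0 g (colv (X t)) (colv (Y t)) : RB).
Proof.
apply: (measurableT_comp (measurable_split_map m0 g)
  (g := fun t => (X t, Y t))).
by apply: measurable_fun_pair.
Qed.

End split_law.

Theorem corollary3p6 (R : realType) (p k : nat) (m0 m1 : R)
    (hm0 : 0 < m0 < 1) (hm1 : m1 = 1 - m0)
    (* Fisher information at theta_0, and its symmetric square root *)
    (FI S : 'M[R]_(p + k)) (hFI : posdefmx FI) (hS : is_sqrtmx FI S)
    (* limit of the local null parameter spaces *)
    (H0 : set 'cV[R]_(p + k))
    (hH0 : [set S *m u | u in H0] = [set x : 'cV[R]_(p + k) | usubmx x = 0])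
    (h : 'cV[R]_(p + k))
    (d1 : measure_display) (T1 : measurableType d1) (P1 : probability T1 R)
    (X1 Y1 : {mfun T1 >-> (p + k).-tuple (measurableTypeR R)})
    (hX1 : std_normal_vec P1 X1) (hY1 : std_normal_vec P1 Y1)
    (hXY1 : indep_vec P1 X1 Y1)
    (d2 : measure_display) (T2 : measurableType d2) (P2 : probability T2 R)
    (X2 Y2 : {mfun T2 >-> (p + k).-tuple (measurableTypeR R)})
    (hX2 : std_normal_vec P2 X2) (hY2 : std_normal_vec P2 Y2)
    (hXY2 : indep_vec P2 X2 Y2) :
  let Lambda t := slr_limit m0 m1 S H0 h (colv (X1 t)) (colv (Y1 t)) in
  let htilde : 'cV[R]_p := usubmx (S *m h) in
  eq_in_law P1 P2 Lambda
    (fun t => enorm (usubmx (colv (X2 t)) + Num.sqrt m0 *: htilde) ^+ 2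
              - enorm (colv (X2 t) - Num.sqrt (m0 / m1) *: colv (Y2 t)) ^+ 2)
  /\ has_law P1 Lambda
       (split_chi2 p k m0 ((htilde^T *m htilde) 0 0)).
Proof.
move=> Lambda htilde.
have LambdaE :
    Lambda = fun t => split_stat m0 htilde (colv (X1 t)) (colv (Y1 t)).
  apply/funext => t; rewrite /Lambda /slr_limit hH0 edist_usubmx0 hm1.
  by rewrite /split_stat raddfD /= linearZ.
rewrite LambdaE hm1; split; first split.
- exact: measurable_split_stat.
- exact: measurable_split_stat.
- move=> A mA; rewrite (pushforward_split_stat m0 htilde hX1 hY1 hXY1 mA).
  by rewrite (pushforward_split_stat m0 htilde hX2 hY2 hXY2 mA).
split; first exact: measurable_split_stat.
move=> A mA.
rewrite (pushforward_split_stat m0 htilde hX1 hY1 hXY1 mA).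
apply: split_map_law => //; apply/matrixP => i j; rewrite !ord1.
(* [htilde] itself lies in [G], so the vector selected by [xget] is not the default 0 by failure of
   existence but a member of [G], with the same squared norm as [htilde]. *)
pose G := [set g : 'cV[R]_p | (g^T *m g) 0 0 = (htilde^T *m htilde) 0 0].
exact/esym/(@xgetPex _ 0 G (ex_intro _ htilde erefl)).
Qed.
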